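(* Let $(X, \|\cdot\|_X)$ be a separable Banach space, and let $\mu$ and $\mu_n$, $n = 1, 2, \ldots$, be Borel probability measures on $X$ such that the sequence $(\mu_n)$ converges weakly to $\mu$ in $X$. Then there exists a separable Banach space $(Y, \|\cdot\|_Y)$, compactly embedded into $X$, such that all the measures $\mu$, $\mu_n$ are concentrated on $Y$, i.e. $\mu(X \setminus Y) = 0$ and $\mu_n(X \setminus Y) = 0$ for all $n$, and moreover $(\mu_n)$ converges weakly to $\mu$ also in the space $Y$, i.e. for every bounded functional $F : Y \to \mathbb{R}$ that is continuous with respect to the norm $\|\cdot\|_Y$, $$\lim_{n \to \infty} \int_Y F(y)\, \mu_n(dy) = \int_Y F(y)\, \mu(dy).$$
   Context: Compact embedding: a Banach space $(Y, \|\cdot\|_Y)$ is said to be compactly embedded into the Banach space $(X, \|\cdot\|_X)$ if $Y$ is a linear subspace of $X$ (equipped with its own complete norm $\|\cdot\|_Y$, in general different from $\|\cdot\|_X$) and the closed unit ball $B_Y = \{y \in Y : \|y\|_Y \le 1\}$ is pre-compact in $X$, i.e. the closure of $B_Y$ in the norm topology of $X$ is a compact subset of $X$. Weak convergence in $X$: $\mu_n \to \mu$ weakly in $X$ means that $\lim_{n\to\infty} \int_X F(x)\, \mu_n(dx) = \int_X F(x)\, \mu(dx)$ for every bounded functional $F : X \to \mathbb{R}$ continuous with respect to $\|\cdot\|_X$. Measures concentrated on $Y$ are regarded as measures on $Y$ by restriction to the Borel sets of $(Y,\|\cdot\|_Y)$; since $Y$ is a separable Banach space continuously embedded in the separable Banach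 space $X$, the Borel sets of $(Y, \|\cdot\|_Y)$ are Borel subsets of $X$. *)

(* Defs.v *)
From HB Require Import structures.
From mathcomp Require Import all_boot all_order all_algebra.
From mathcomp Require Import all_classical all_reals all_analysis.

Set Implicit Arguments.
Unset Strict Implicit.
Unset Printing Implicit Defensive.

Import Order.TTheory GRing.Theory Num.Theory.
Import numFieldNormedType.Exports.

Local Open Scope classical_set_scope.
Local Open Scope ring_scope.

Definition separable (T : topologicalType) : Prop :=
  exists S : set T, countable S /\ dense S.

Notation borel X := (g_sigma_algebraType (@open X)).

(* The subspace [Y] of [X] is encoded as a Banach space of its own together
   with its inclusion map [j]. *)
Definition compact_embedding (R : realType) (Y X : completeNormedModType R)
    (j : {linear Y -> X}) : Prop :=
  injective j /\ compact (closure (j @` [set y : Y | `|y| <= 1])).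

Definition weak_cvg (R : realType) (X : completeNormedModType R)
    (mu_ : nat -> probability (borel X) R) (mu : probability (borel X) R) : Prop :=
  forall F : X -> R, continuous F -> bounded_fun F ->
    (\int[mu_ n]_(x in [set: borel X]) (F x)%:E)%E @[n --> \oo]
      --> (\int[mu]_(x in [set: borel X]) (F x)%:E)%E.

(* The measurability conjunct matters: a [probability] is a total function on
   sets, so [mu (~` A)] alone says nothing when [A] is not Borel. *)
Definition concentrated_on (R : realType) (X : completeNormedModType R)
    (mu : probability (borel X) R) (A : set (borel X)) : Prop :=
  measurable A /\ mu (~` A) = 0%E.

(* [nu] is [mu] restricted to the Borel sets of [Y], seen as subsets of [X]
   through [j]; this determines [nu] on all Borel sets of [Y]. *)
Definition is_restriction (R : realType) (Y X : completeNormedModType R)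
    (j : Y -> X) (mu : probability (borel X) R) (nu : probability (borel Y) R) :
    Prop :=
  forall B : set (borel Y), measurable B ->
    measurable (j @` B : set (borel X)) /\ nu B = mu (j @` B).

(* Main.v *)
(* Fix a dense sequence of X and let V_n be the span of its first n terms. The
   functions min(1, d(., V_n)) are continuous and decrease to 0, so by dominated
   convergence and weak convergence their integrals become small uniformly over
   all the measures; no appeal to Prokhorov's theorem is needed. One can thus
   pick N_0 = 0 <= N_1 <= ... such that all the measures give mass at most 2^-k
   to { d(., V_(N_k)) > 4^-k } for k >= 1. Let Y be the space of the x such that
   p_k(x) = 2^k d(x, V_(N_k)) tends to 0, normed by sup_k p_k (note that p_0 is
   the norm of X). It is complete like c_0, the union of the V_(N_k) is dense in
   it, and its unit ball is totally bounded in X. The closed sets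
   K_m = { x | d(x, V_(N_k)) <= 4^-k for all k >= m } are contained in Y, carry
   almost all the mass uniformly, and inherit the same topology from X and Y.
   Hence a bounded continuous function on Y agrees on K_m with a bounded
   continuous function on X (Tietze), and weak convergence passes from X to Y. *)
Require Import Defs.
From HB Require Import structures.
From mathcomp Require Import all_boot all_order all_algebra.
From mathcomp Require Import all_classical all_reals all_analysis.
From mathcomp Require Import measurable_realfun ring lra.

Set Implicit Arguments.
Unset Strict Implicit.
Unset Printing Implicit Defensive.

Import Order.TTheory GRing.Theory Num.Theory.
Import numFieldNormedType.Exports.

Local Open Scope classical_set_scope.
Local Open Scope ring_scope.

(** * The c_0-type space of a sequence of seminorms *)

Section C0Space.
Variables (R : realType) (X : completeNormedModType R) (p : nat -> X -> R).
Hypothesis p0 : forall x, p 0%N x = `|x|.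
Hypothesis pD : forall k x y, p k (x + y) <= p k x + p k y.
Hypothesis pZ : forall k c x, p k (c *: x) = `|c| * p k x.
Hypothesis p_bounded : forall k, exists C : R, forall x, p k x <= C * `|x|.

Lemma seminorm0 k : p k 0 = 0.
Proof. by rewrite -(scale0r 0) pZ normr0 mul0r. Qed.

Lemma seminormN k x : p k (- x) = p k x.
Proof. by rewrite -scaleN1r pZ normrN1 mul1r. Qed.

Lemma seminorm_ge0 k x : 0 <= p k x.
Proof.
have := pD k x (- x); rewrite subrr seminorm0 seminormN; lra.
Qed.

(** A boolean predicate, so that closure under linear combinations can be registered and the subtype
    inherits a module structure. *)
Definition vanishing : {pred X} := fun x => `[< p ^~ x @ \oo --> (0 : R) >].

Lemma vanishingP x : reflect (p ^~ x @ \oo --> (0 : R)) (x \in vanishing).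
Proof. exact: asboolP. Qed.

Lemma vanishing_submod_closed : submod_closed vanishing.
Proof.
split=> [|a x y /vanishingP px /vanishingP py]; apply/vanishingP.
  rewrite (_ : p ^~ 0 = cst 0); first exact: cvg_cst.
  by apply/funext => k; rewrite seminorm0.
apply: (@squeeze_cvgr _ _ _ _ (cst 0) (fun k => `|a| * p k x + p k y)).
- by near=> k; rewrite seminorm_ge0/= (le_trans (pD _ _ _))// pZ.
- exact: cvg_cst.
- rewrite (_ : nbhs 0 = nbhs (`|a| * 0 + 0)); last by rewrite mulr0 addr0.
  by apply: cvgD => //; apply: cvgMr.
Unshelve. all: by end_near. Qed.

HB.instance Definition _ :=
  GRing.isSubmodClosed.Build R X vanishing vanishing_submod_closed.

(** A separate type, because its norm is not the one that a subspace inherits from [X]. *)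
Record c0_space := C0Space {c0_val : X; _ : c0_val \in vanishing}.

HB.instance Definition _ := [isSub for c0_val].
HB.instance Definition _ := [Choice of c0_space by <:].
HB.instance Definition _ := [SubChoice_isSubLmodule of c0_space by <:].

Definition c0_norm (y : c0_space) : R := sup (range (p ^~ (val y))).

(** The supremum is a genuine upper bound because a convergent sequence is bounded. *)
Lemma seminorm_le_c0_norm k y : p k (val y) <= c0_norm y.
Proof.
apply: ub_le_sup; last by exists k.
have /vanishingP py := valP y.
have /cvg_seq_bounded[M [Mr MB]] : cvgn (p ^~ (val y)).
  by apply/cvg_ex; exists 0.
exists (M + 1) => _ [i _ <-].
by rewrite (le_trans (ler_norm _))// MB// ltrDl.
Qed.

Lemma c0_norm_le y M : (forall k, p k (val y) <= M) -> c0_norm y <= M.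
Proof.
by move=> pM; apply: ge_sup; [exists (p 0 (val y)), 0%N|move=> _ [k _ <-]].
Qed.

Lemma c0_normD x y : c0_norm (x + y) <= c0_norm x + c0_norm y.
Proof.
apply: c0_norm_le => k; rewrite (le_trans (pD _ _ _))//.
by rewrite lerD// seminorm_le_c0_norm.
Qed.

Lemma c0_normZ (a : R) x : c0_norm (a *: x) = `|a| * c0_norm x.
Proof.
(* One inequality for all scalars suffices: applied to [a^-1] it gives the reverse one. *)
have le_normZ b z : c0_norm (b *: z) <= `|b| * c0_norm z.
  apply: c0_norm_le => k.
  by rewrite pZ ler_wpM2l// seminorm_le_c0_norm.
apply/le_anti; rewrite le_normZ/=.
have [->|a0] := eqVneq a 0.
  by rewrite normr0 mul0r (le_trans (seminorm_ge0 0 _) (seminorm_le_c0_norm 0 _)).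
rewrite -ler_pdivlMl ?normr_gt0// -normfV.
by rewrite -{1}[x](scalerK a0) le_normZ.
Qed.

Lemma c0_norm_eq0 x : c0_norm x = 0 -> x = 0.
Proof.
move=> x0; apply/val_inj/normr0_eq0/le_anti.
by rewrite normr_ge0 -p0 -{1}x0 seminorm_le_c0_norm.
Qed.

HB.instance Definition _ :=
  Lmodule_isNormed.Build R c0_space c0_normD c0_normZ c0_norm_eq0.

(** As [p 0] is the norm of [X], a Cauchy filter has a limit [x] in [X]. Each [p k] is continuous on
    [X], so the Cauchy bounds pass to [x] uniformly in [k], and a uniform limit of sequences tending
    to 0 tends to 0. *)
Lemma c0_complete (F : set_system c0_space) :
  ProperFilter F -> cauchy F -> cvg F.
Proof.
move=> FF /cauchyP F_cauchy.
have val_norm (y : c0_space) : `|val y| <= `|y|.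
  by rewrite -p0 seminorm_le_c0_norm.
have valB (y z : c0_space) : val y - val z = val (y - z) by [].
have : cauchy (val @ F).
  apply/cauchyP => e e0; have [y Fy] := F_cauchy e e0; exists (val y).
  change (F (val @^-1` ball (val y) e)).
  apply: filterS Fy => z; rewrite -!ball_normE /= valB.
  exact: le_lt_trans.
move=> /cauchy_cvg/cvg_ex[x Fx].
have p_close (e : R) : 0 < e -> exists y : c0_space,
    F (ball y e) /\ forall k, p k (x - val y) <= e.
  move=> e0; have [y Fy] := F_cauchy e e0; exists y; split=> // k.
  apply/ler_addgt0Pr => d d0; have [C pC] := p_bounded k.
  (* [z] may depend on [k] and [d]: it lies in the Cauchy ball of [y], and so close to [x] that
     [p k (x - val z) <= d]. *)
  have [z [yz xz]] : exists z, ball y e z /\ ball x (d / (`|C| + 1)) (val z).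
    near F => z; exists z; split; first by near: z; exact: Fy.
    near: z; apply: (Fx (ball x (d / (`|C| + 1)))); apply: nbhsx_ballx.
    by rewrite divr_gt0// ltr_wpDl.
  rewrite -(subrK (val z) x) -addrA addrC (le_trans (pD _ _ _))// lerD//.
    rewrite valB (le_trans (seminorm_le_c0_norm _ _))//.
    by move: yz; rewrite -ball_normE/= -normrN opprB => /ltW.
  move: xz; rewrite -ball_normE/= ltr_pdivlMr ?ltr_wpDl// => /ltW; apply: le_trans.
  rewrite (le_trans (pC _))// mulrC ler_wpM2l//.
  by rewrite (le_trans (ler_norm _))// lerDl.
have x_vanishing : x \in vanishing.
  apply/vanishingP/cvgr0Pnorm_lt => e e0.
  have e20 : 0 < e / 2 by rewrite divr_gt0.
  have [y [_ xy]] := p_close (e / 2) e20.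
  have /vanishingP/cvgr0Pnorm_lt/(_ (e / 2) e20) := valP y.
  apply: filterS => k; rewrite !ger0_norm ?seminorm_ge0// => py.
  rewrite -(subrK (val y) x) (le_lt_trans (pD _ _ _))// [e]splitr.
  by rewrite ler_ltD.
apply/cvg_ex; exists (C0Space x_vanishing); apply/cvgrPdist_le => e e0.
have e20 : 0 < e / 2 by rewrite divr_gt0.
have [y [Fy xy]] := p_close (e / 2) e20.
apply: filterS Fy => z; rewrite -ball_normE/= => /ltW yz.
rewrite -(subrK y (C0Space _)) -addrA (le_trans (ler_normD _ _))// [e]splitr.
by rewrite lerD//; apply: c0_norm_le => k; rewrite raddfB/= xy.
Unshelve. all: by end_near. Qed.

HB.instance Definition _ := Uniform_isComplete.Build c0_space c0_complete.

(** The last two clauses together say that the norm is the supremum of the [p k]. Later arguments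
    use only this interface. *)
Lemma exists_c0_space :
  exists (Y : completeNormedModType R) (j : {linear Y -> X}),
    [/\ injective j,
        range j = [set x | p ^~ x @ \oo --> (0 : R)],
        (forall k y, p k (j y) <= `|y|) &
        (forall y M, (forall k, p k (j y) <= M) -> `|y| <= M)].
Proof.
exists c0_space, (val : {linear c0_space -> X}); split.
- exact: val_inj.
- apply/seteqP; split=> [_ [y _ <-]|x px]; first exact/vanishingP/valP.
  by have /vanishingP vx := px; exists (C0Space vx).
- by move=> k y; exact: seminorm_le_c0_norm.
- by move=> y M; exact: c0_norm_le.
Qed.

End C0Space.

(** * Total boundedness *)

Section TotallyBounded.
Variables (R : realType) (X : completeNormedModType R).
Implicit Types (A B : set X) (e : R).

Definition totally_bounded A := forall e, 0 < e ->
  exists t : seq X, forall x, A x -> exists2 w, w \in t & `|x - w| < e.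

(** If the first piece is not in the ultrafilter, its complement is, and intersecting with it leaves
    a shorter list. *)
Lemma ultra_seq (F : set_system X) (I : eqType) (t : seq I) (P : I -> set X) :
    UltraFilter F -> F [set x | exists2 i, i \in t & P i x] ->
  exists2 i, i \in t & F (P i).
Proof.
move=> FU; elim: t => [|i t IHt] Ft.
  by have /filter_ex[x [?]] := Ft.
have [Fi|FNi] := in_ultra_setVsetC (P i) FU.
  by exists i; rewrite ?mem_head.
have [|k kt Fk] := IHt.
  apply: filterS2 Ft FNi => x [k]; rewrite inE => /orP[/eqP->//|kt Pk _].
  by exists k.
by exists k; rewrite // inE kt orbT.
Qed.

(** An ultrafilter on [A] contains a ball of every radius, so it is Cauchy and converges by
    completeness; closedness puts the limit in [A]. *)
Lemma totally_bounded_compact A : totally_bounded A -> closed A -> compact A.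
Proof.
move=> Atb Acl; rewrite compact_ultra => F FU FA.
have /cauchy_cvg/cvg_ex[x Fx] : cauchy F.
  apply/cauchyP => e e0; have [t tA] := Atb e e0.
  have [|w _ Fw] := @ultra_seq F X t (fun w => ball w e) FU; last by exists w.
  apply: filterS FA => x /tA[w wt xw]; exists w => //.
  by rewrite -ball_normE/= distrC.
exists x; split => //; apply: Acl => B /Fx FB.
exact: filter_ex (filterI FA FB).
Qed.

Lemma compact_totally_bounded A : compact A -> totally_bounded A.
Proof.
rewrite compact_cover => Aco e e0.
have [|x Ax|D _ AD] := Aco X setT (fun w => ball w e).
- by move=> w _; apply: ball_open.
- by exists x => //; exact: ballxx.
exists (finmap.enum_fset D) => x /AD[w wD]; rewrite -ball_normE/= distrC => xw.
by exists w.
Qed.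

Lemma sub_totally_bounded A B : A `<=` B -> totally_bounded B -> totally_bounded A.
Proof. by move=> AB Btb e /Btb[t tB]; exists t => x /AB/tB. Qed.

(** A net of [B] at scale [e / 2] is a net of [A] at scale [e]. Since [B] may depend on [e],
    finite-dimensional sets of growing dimension can serve. *)
Lemma totally_bounded_approx A :
  (forall e, 0 < e -> exists2 B, totally_bounded B &
    forall x, A x -> exists2 y, B y & `|x - y| < e) -> totally_bounded A.
Proof.
move=> AB e e0; have e20 : 0 < e / 2 by rewrite divr_gt0.
have [B Btb xB] := AB _ e20; have [t tB] := Btb _ e20.
exists t => x /xB[y /tB[w wt yw] xy]; exists w => //.
by rewrite -(subrKA y) (le_lt_trans (ler_normD _ _))// [e]splitr ltrD.
Qed.

Lemma totally_boundedD A B : totally_bounded A -> totally_bounded B ->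
  totally_bounded [set x + y | x in A & y in B].
Proof.
move=> Atb Btb e e0; have e20 : 0 < e / 2 by rewrite divr_gt0.
have [t tA] := Atb _ e20; have [u uB] := Btb _ e20.
exists [seq v + w | v <- t, w <- u] => _ [x Ax [y By <-]].
have [v vt xv] := tA x Ax; have [w wu yw] := uB y By.
exists (v + w); first by apply/allpairsP; exists (v, w).
by rewrite opprD addrACA (le_lt_trans (ler_normD _ _))// [e]splitr ltrD.
Qed.

Lemma totally_bounded_segment (M : R) (x : X) :
  totally_bounded [set c *: x | c in [set c | `|c| <= M]].
Proof.
apply: compact_totally_bounded.
apply: (@continuous_compact R X (fun c => c *: x)).
  apply: continuous_subspaceT => c; exact: scalel_continuous.
rewrite (_ : [set c | _] = `[- M, M]%classic); first exact: segment_compact.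
by apply/seteqP; split => c /=; rewrite in_itv/= ler_norml.
Qed.

End TotallyBounded.

(** * Distance to a subspace *)

Section SubspaceDistance.
Variables (R : realType) (X : completeNormedModType R).
Implicit Types (V : set X) (x y : X) (e : R).

Definition subspace_dist V x : R := inf [set `|x - v| | v in V].

Definition is_subspace V :=
  V 0 /\ forall c x y, V x -> V y -> V (c *: x + y).

Lemma is_subspaceD V x y : is_subspace V -> V x -> V y -> V (x + y).
Proof. by move=> [_ VL] Vx Vy; rewrite -[x]scale1r; exact: VL. Qed.

Lemma is_subspaceZ V c x : is_subspace V -> V x -> V (c *: x).
Proof. by move=> [V0 VL] Vx; rewrite -[_ *: _]addr0; exact: VL. Qed.

Lemma subspace_dist_le V x v : V v -> subspace_dist V x <= `|x - v|.
Proof. by move=> Vv; apply: ge_inf; [exists 0 => _ [w _ <-]|exists v]. Qed.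

Lemma subspace_dist_ge V x e : is_subspace V ->
  (forall v, V v -> e <= `|x - v|) -> e <= subspace_dist V x.
Proof.
move=> [V0 _] eV; apply: lb_le_inf; first by exists `|x - 0|, 0.
by move=> _ [v Vv <-]; exact: eV.
Qed.

Lemma subspace_dist_approx V x e : is_subspace V -> subspace_dist V x < e ->
  exists2 v, V v & `|x - v| < e.
Proof.
move=> VS xe; apply/not_exists2P => nV.
suff : e <= subspace_dist V x by rewrite leNgt xe.
apply: subspace_dist_ge => // v Vv; rewrite leNgt; apply/negP => xv.
by have [] := nV v.
Qed.

Lemma subspace_dist_ge0 V x : is_subspace V -> 0 <= subspace_dist V x.
Proof. by move=> VS; exact: subspace_dist_ge. Qed.

Lemma subspace_dist_mem V x : is_subspace V -> V x -> subspace_dist V x = 0.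
Proof.
move=> VS Vx; apply/le_anti; rewrite subspace_dist_ge0// andbT.
by rewrite (le_trans (subspace_dist_le x Vx))// subrr normr0.
Qed.

Lemma subspace_distD V x y : is_subspace V ->
  subspace_dist V (x + y) <= subspace_dist V x + subspace_dist V y.
Proof.
move=> VS; apply/ler_addgt0Pr => e e0.
have dlt z : subspace_dist V z < subspace_dist V z + e / 2.
  by rewrite ltrDl divr_gt0.
have [v Vv xv] := subspace_dist_approx VS (dlt x).
have [w Vw yw] := subspace_dist_approx VS (dlt y).
rewrite (le_trans (subspace_dist_le _ (is_subspaceD VS Vv Vw)))//.
rewrite opprD addrACA (le_trans (ler_normD _ _))//.
by rewrite [e]splitr addrACA ltW// ltrD.
Qed.

Lemma subspace_distZ V c x : is_subspace V ->
  subspace_dist V (c *: x) = `|c| * subspace_dist V x.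
Proof.
move=> VS.
(* Taking [b] to be [c] gives one inequality, and [c^-1] the other. *)
have leZ b z : b != 0 -> `|b| * subspace_dist V z <= subspace_dist V (b *: z).
  move=> b0; apply: subspace_dist_ge => // v Vv.
  rewrite -(scalerKV b0 v) -scalerBr normrZ ler_wpM2l//.
  by apply: subspace_dist_le; exact: is_subspaceZ.
have [->|c0] := eqVneq c 0.
  by rewrite scale0r normr0 mul0r subspace_dist_mem//; case: VS.
apply/le_anti; rewrite leZ// andbT.
rewrite -ler_pdivrMl ?normr_gt0// -normfV.
by rewrite -{2}[x](scalerK c0) leZ// invr_eq0.
Qed.

Lemma subspace_dist_norm V x : is_subspace V -> subspace_dist V x <= `|x|.
Proof. by move=> [V0 _]; rewrite -{2}[x]subr0 subspace_dist_le. Qed.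

Lemma subspace_dist_anti V W x : is_subspace V -> V `<=` W ->
  subspace_dist W x <= subspace_dist V x.
Proof.
move=> VS VW; apply: subspace_dist_ge => // v /VW; exact: subspace_dist_le.
Qed.

Lemma subspace_dist_set0 x : subspace_dist [set 0] x = `|x|.
Proof. by rewrite /subspace_dist image_set1 inf1 subr0. Qed.

Lemma subspace_distB V x y : is_subspace V ->
  `|subspace_dist V x - subspace_dist V y| <= `|x - y|.
Proof.
move=> VS.
have le1 a b : subspace_dist V a - subspace_dist V b <= `|a - b|.
  rewrite lerBlDr -{1}(subrK b a) (le_trans (subspace_distD _ _ VS))//.
  by rewrite lerD2r subspace_dist_norm.
by rewrite ler_norml lerNl opprB distrC le1 distrC le1.
Qed.

Lemma continuous_subspace_dist V : is_subspace V -> continuous (subspace_dist V).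
Proof.
move=> VS x; apply/cvgrPdist_le => e e0.
apply: filterS (nbhsx_ballx x e e0) => y; rewrite -ball_normE/= => /ltW.
exact/le_trans/subspace_distB.
Qed.

End SubspaceDistance.

(** * Finite-dimensional flags spanned by a sequence *)

Section Flag.
Variables (R : realType) (X : completeNormedModType R) (s : nat -> X).

(** The span of the first [n] terms of [s], built one term at a time for induction; the terms may be
    linearly dependent. *)
Fixpoint flag n : set X :=
  if n is m.+1 then [set v + c *: s m | v in flag m & c in [set: R]] else [set 0].

Lemma flag_subspace n : is_subspace (flag n).
Proof.
elim: n => [|n [V0 VL]]; split=> //=.
- by move=> c x y -> ->; rewrite scaler0 addr0.
- by exists 0 => //; exists 0; rewrite // scale0r addr0.
move=> c _ _ [v Vv [a _ <-]] [w Vw [b _ <-]]; exists (c *: v + w); first exact: VL.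
by exists (c * a + b) => //; rewrite scalerDl scalerDr scalerA addrACA.
Qed.

Lemma flag_mono m n : (m <= n)%N -> flag m `<=` flag n.
Proof.
move=> /subnK<-; elim: (n - m)%N => // k IHk x /IHk kx.
by rewrite addSn; exists x => //; exists 0; rewrite // scale0r addr0.
Qed.

Lemma mem_flag n : flag n.+1 (s n).
Proof.
exists 0; first by have [] := flag_subspace n.
by exists 1; rewrite // scale1r add0r.
Qed.

(** A term of [s] within [e] of [x] belongs to all later flags. *)
Lemma subspace_dist_flag_cvg x : dense (range s) ->
  subspace_dist (flag n) x @[n --> \oo] --> (0 : R).
Proof.
move=> sD; apply/cvgr0Pnorm_lt => e e0.
have [|_ [/[swap] [[k _ <-]]]] := sD (ball x e) _ (ball_open x e).
  by exists x; exact: ballxx.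
rewrite -ball_normE/= => sk; exists k.+1 => // n /= kn.
rewrite ger0_norm ?subspace_dist_ge0//; last exact: flag_subspace.
apply: le_lt_trans sk; apply: subspace_dist_le.
exact: flag_mono kn _ (mem_flag k).
Qed.

(* If [s n] is at positive distance from [flag n], the coefficient on [s n] of a
   bounded vector is bounded; otherwise [flag n] is dense in [flag n.+1]. *)
Lemma flag_totally_bounded n (M : R) :
  totally_bounded [set v | flag n v /\ `|v| <= M].
Proof.
elim: n M => [|n IHn] M.
  move=> e e0; exists [:: 0] => v [-> _]; exists 0; rewrite ?mem_head//.
  by rewrite subr0 normr0.
have VS := flag_subspace n; set d := subspace_dist (flag n) (s n).
have := subspace_dist_ge0 (s n) VS; rewrite le_eqVlt => /orP[/eqP d0|d0].
  apply: totally_bounded_approx => e e0.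
  exists [set v | flag n v /\ `|v| <= M + e] => //.
  move=> _ [[v Vv [c _ <-]] xM].
  have xd : subspace_dist (flag n) (v + c *: s n) < e.
    rewrite (le_lt_trans (subspace_distD _ _ VS))// subspace_distZ// -d0 mulr0.
    by rewrite addr0 subspace_dist_mem.
  have [w Vw xw] := subspace_dist_approx VS xd; exists w => //; split=> //.
  rewrite -(subrK (v + c *: s n) w) addrC (le_trans (ler_normD _ _))// lerD//.
  by rewrite distrC ltW.
apply: sub_totally_bounded (totally_boundedD
  (IHn (M + M / d * `|s n|)) (totally_bounded_segment (M / d) (s n))).
move=> _ [[v Vv [c _ <-]] xM].
have cM : `|c| <= M / d.
  rewrite ler_pdivlMr// -subspace_distZ// (le_trans _ xM)//.
  rewrite (le_trans _ (subspace_dist_norm _ VS))//.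
  rewrite -{1}(addKr v (c *: s n)) (le_trans (subspace_distD _ _ VS))//.
  by rewrite subspace_dist_mem ?add0r// -scaleN1r; exact: is_subspaceZ.
exists v; last by exists (c *: s n) => //; exists c.
split=> //; rewrite -(addrK (c *: s n) v) (le_trans (ler_normB _ _))// lerD//.
by rewrite normrZ ler_wpM2r.
Qed.

(** Rational combinations form a countable dense subset of [flag n], from which the separability of
    [Y] will follow. *)
Fixpoint rational_flag n : set X :=
  if n is m.+1 then
    [set v + ratr q *: s m | v in rational_flag m & q in [set: rat]]
  else [set 0].

Lemma countable_rational_flag n : countable (rational_flag n).
Proof.
elim: n => [|n IHn] /=; first exact: countable1.
rewrite image2E; apply: sub_countable (card_image_le _ _) _.
exact/countableX/countableP.
Qed.

Lemma rational_flag_sub n : rational_flag n `<=` flag n.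
Proof.
by elim: n => [|n IHn] _ //= [v /IHn Vv [q _ <-]]; exists v => //; exists (ratr q).
Qed.

Lemma rational_flag_dense n x (e : R) : flag n x -> 0 < e ->
  exists2 y, rational_flag n y & `|x - y| < e.
Proof.
elim: n x e => [|n IHn] x e /=.
  by move=> -> e0; exists 0; rewrite // subr0 normr0.
move=> [v Vv [c _ <-]] e0; have e20 : 0 < e / 2 by rewrite divr_gt0.
have [w Vw vw] := IHn v _ Vv e20.
(* The coefficient error times [|s n|] must stay below [e / 2]; the added 1 keeps the divisor
   nonzero. *)
have d0 : 0 < e / 2 / (`|s n| + 1) by rewrite divr_gt0// ltr_wpDl.
have [q] : exists q, ratr q \in `]c, c + e / 2 / (`|s n| + 1)[.
  by apply: rat_in_itvoo; rewrite ltrDl.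
rewrite in_itv/= => /andP[cq qc].
exists (w + ratr q *: s n); first by exists w => //; exists q.
rewrite opprD addrACA (le_lt_trans (ler_normD _ _))// [e]splitr ltr_leD//.
rewrite -scalerBl normrZ distrC ger0_norm; last by rewrite subr_ge0 ltW.
rewrite (@le_trans _ _ (e / 2 / (`|s n| + 1) * (`|s n| + 1)))//.
  by rewrite ler_pM// ?subr_ge0 ?lerBlDl ?ltW// ltrDl.
by rewrite divfK// gt_eqF// ltr_wpDl.
Qed.

End Flag.

(** * Borel sets and functions *)

Section BorelSets.
Variables (R : realType).
Implicit Types X Y : completeNormedModType R.

Lemma separable_seq X : separable X -> exists s : nat -> X, dense (range s).
Proof.
move=> [S [/pfcard_geP[S0|[s]] SD]].
  have [|x []] := SD setT _ openT; first by exists 0.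
  by rewrite S0.
exists s => U U0 oU; have [x [Ux Sx]] := SD U U0 oU.
by exists x; split => //; have [n _ <-] := @surj _ _ _ _ s x Sx; exists n.
Qed.

Lemma borel_open X (U : set X) : open U -> measurable (U : set (borel X)).
Proof. by move=> oU; apply: sub_sigma_algebra. Qed.

Lemma borel_closed X (A : set X) : closed A -> measurable (A : set (borel X)).
Proof. by move=> /closed_openC/borel_open/measurableC; rewrite setCK. Qed.

Lemma continuous_borel_fun X (f : X -> R) : continuous f ->
  measurable_fun [set: borel X] (f : borel X -> R).
Proof.
move=> /continuousP cf; apply: (measurability _ (RGenOpens.measurableE R)).
move=> _ [_ [a [b ->] <-]]; rewrite setTI.
apply: borel_open; apply: cf; exact: interval_open.
Qed.

(** In a separable space every open set is a countable union of closed balls with centres [s n] and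
    radii [1/(k+1)]. *)
Lemma borel_fun_closed_ball X Y (g : X -> Y) : separable Y ->
    (forall y (e : R),
      measurable (g @^-1` [set z | `|y - z| <= e] : set (borel X))) ->
  measurable_fun [set: borel X] (g : borel X -> borel Y).
Proof.
move=> /separable_seq[s sD] mg.
apply: (@measurability _ _ (borel X) (borel Y) setT g open) => //.
move=> _ [U oU <-]; rewrite setTI.
pose B (i : nat * nat) := [set z | `|s i.1 - z| <= i.2.+1%:R^-1].
pose D := [set i | B i `<=` U].
have -> : U = \bigcup_(i in D) B i.
  apply/seteqP; split=> [x Ux|x [i Di Bix]]; last exact: Di.
  have [e /= e0 eU] : nbhs_ball x U by apply/nbhs_ballP; exact: open_nbhs_nbhs.
  have [k ke] : exists k, k.+1%:R^-1 < e / 2.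
    have [|k] := @ltr_add_invr R 0 (e / 2); first by rewrite divr_gt0.
    by rewrite add0r; exists k.
  have k0 : 0 < k.+1%:R^-1 :> R by rewrite invr_gt0.
  have [|_ [/[swap] [[n _ <-]]]] := sD (ball x k.+1%:R^-1) _ (ball_open x _).
    by exists x; exact: ballxx.
  rewrite -ball_normE/= => xn; exists (n, k); last by rewrite /B/= distrC ltW.
  move=> z /= nz; apply: eU; rewrite -ball_normE/= -(subrKA (s n)).
  rewrite (le_lt_trans (ler_normD _ _))// [e]splitr ltrD//.
    exact: lt_trans xn ke.
  exact: le_lt_trans nz ke.
rewrite preimage_bigcup bigcup_mkcond; apply: countable_bigcupT_measurable => //.
by move=> i; case: ifPn => // _; exact: mg.
Qed.

End BorelSets.

(** * The compactly embedded space *)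

Lemma closed_sublevel (R : realType) (T : topologicalType) (f : T -> R) a :
  continuous f -> closed [set x | f x <= a].
Proof.
move=> cf; apply: (@preimage_closed _ _ f [set y | y <= a]) => //; exact: closed_le.
Qed.

Section WeightedDistance.
Variables (R : realType) (X : completeNormedModType R) (s : nat -> X).
Variable N : nat -> nat.
Hypothesis N0 : N 0%N = 0%N.
Hypothesis N_mono : {homo N : m n / (m <= n)%N}.

Definition weighted_dist k x : R := 2 ^+ k * subspace_dist (flag s (N k)) x.

Let p := weighted_dist.

Let VS k : is_subspace (flag s (N k)). Proof. exact: flag_subspace. Qed.

Lemma weighted_dist0 x : p 0 x = `|x|.
Proof. by rewrite /p /weighted_dist N0 expr0 mul1r subspace_dist_set0. Qed.

Lemma weighted_distD k x y : p k (x + y) <= p k x + p k y.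
Proof. by rewrite -mulrDr ler_wpM2l ?exprn_ge0// subspace_distD. Qed.

Lemma weighted_distZ k c x : p k (c *: x) = `|c| * p k x.
Proof. by rewrite /p /weighted_dist subspace_distZ// mulrCA. Qed.

Lemma weighted_dist_le_norm k x : p k x <= 2 ^+ k * `|x|.
Proof. by rewrite ler_wpM2l ?exprn_ge0// subspace_dist_norm. Qed.

Lemma weighted_dist_ge0 k x : 0 <= p k x.
Proof. by rewrite mulr_ge0 ?exprn_ge0// subspace_dist_ge0. Qed.

Lemma weighted_dist_flag k l x : (k <= l)%N -> flag s (N k) x -> p l x = 0.
Proof.
move=> kl kx; rewrite /p /weighted_dist subspace_dist_mem ?mulr0//.
by apply: flag_mono kx; exact: N_mono.
Qed.

Lemma continuous_weighted_dist k : continuous (p k).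
Proof.
move=> x; apply: cvgMr; exact: (continuous_subspace_dist (VS k)).
Qed.

(** Points of this set are within [2^-k] of [flag s (N k)], hence close to bounded parts of
    finite-dimensional spaces, which are totally bounded. Closedness comes from the continuity of
    each [p k]. *)
Lemma weighted_dist_ball_compact :
  compact [set x | forall k, p k x <= 1].
Proof.
apply: totally_bounded_compact.
  apply: totally_bounded_approx => e e0.
  have [k ke] : exists k, 2 * (2^-1) ^+ k < e :> R.
    have : geometric 2 (2^-1) @ \oo --> (0 : R).
      by apply: cvg_geometric; rewrite ger0_norm// invf_lt1// ltr1n.
    move=> /cvgr0Pnorm_lt/(_ e e0)/filter_ex[k /=].
    by rewrite ger0_norm ?mulr_ge0 ?exprn_ge0// => ke; exists k.
  (* Radius 3: [p 0 x <= 1] bounds [x] by 1, and the approximating [v] is within 2 of [x]. *)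
  exists [set v | flag s (N k) v /\ `|v| <= 3]; first exact: flag_totally_bounded.
  move=> x /= px.
  (* The factor 2 gives the strict inequality that [subspace_dist_approx] requires. *)
  have xk : subspace_dist (flag s (N k)) x < 2 * (2^-1) ^+ k.
    rewrite (@le_lt_trans _ _ (2^-1 ^+ k))//; last first.
      by rewrite ltr_pMl ?exprn_gt0// ltr1n.
    have := px k; rewrite /p /weighted_dist exprVn -ler_pdivlMl ?exprn_gt0//.
    by rewrite mulr1.
  have [v Vv xv] := subspace_dist_approx (VS k) xk.
  exists v; last exact: lt_trans xv ke.
  split => //; rewrite -(subrK x v) (le_trans (ler_normD _ _))//.
  have vx2 : `|v - x| <= 2.
    rewrite distrC (le_trans (ltW xv))// ler_piMr// exprn_ile1// invf_le1//.
    by rewrite ler1n.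
  have := px 0%N; rewrite weighted_dist0; lra.
rewrite (_ : mkset _ = \bigcap_k [set x | p k x <= 1]); last first.
  by apply/seteqP; split => x /=; [move=> px k _; exact: px|move=> px k; exact: px].
apply: closed_bigI => k _; apply: closed_sublevel.
exact: continuous_weighted_dist.
Qed.

Section Embedding.
Variables (Y : completeNormedModType R) (j : {linear Y -> X}).
Hypothesis j_inj : injective j.
Hypothesis range_j : range j = [set x | p ^~ x @ \oo --> (0 : R)].
Hypothesis p_le_norm : forall k y, p k (j y) <= `|y|.
Hypothesis norm_le_p : forall y M, (forall k, p k (j y) <= M) -> `|y| <= M.

Lemma c0_compact_embedding : compact_embedding j.
Proof.
split=> //; apply: (subclosed_compact _ weighted_dist_ball_compact).
  exact: closed_closure.
have /closure_id -> : closed [set x | forall k, p k x <= 1].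
  by apply: compact_closed => //; exact: weighted_dist_ball_compact.
apply: closure_subset => _ [y /= y1 <-] k; exact: le_trans (p_le_norm k y) y1.
Qed.

(** Choose [k] beyond which [p l (j y)] is small and approximate [j y] in [X] by some [w] in the
    rational flag at [N k]. For [l >= k] the seminorm [p l] does not see [w]; for [l < k] closeness
    in [X] suffices. *)
Lemma c0_separable : separable Y.
Proof.
exists (\bigcup_k (j @^-1` rational_flag s (N k))); split.
  apply: bigcup_countable => // k _.
  apply: (sub_countable _ (countable_rational_flag s (N k))).
  by apply: card_ge_preimage => a b _ _; exact: j_inj.
move=> U [y Uy] Uo.
have [e /= e0 eU] : nbhs_ball y U by apply/nbhs_ballP; exact: open_nbhs_nbhs.
have e40 : 0 < e / 4 by rewrite divr_gt0.
have : range j (j y) by exists y.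
rewrite range_j /= => /cvgr0Pnorm_lt/(_ (e / 4) e40)[k _ pk].
have py l : (k <= l)%N -> p l (j y) < e / 4.
  by move=> /pk; rewrite ger0_norm// weighted_dist_ge0.
have pow0 : 0 < 2 ^+ k :> R by rewrite exprn_gt0.
have [v kv yv] : exists2 v, flag s (N k) v & `|j y - v| < e / 4 / 2 ^+ k.
  by apply: subspace_dist_approx => //; rewrite ltr_pdivlMr// mulrC py.
have [w kw vw] := rational_flag_dense kv (divr_gt0 e40 pow0).
(* The weights below [k] are at most [2 ^+ k], so this bound settles all indices [l < k] at once. *)
have jyw : 2 ^+ k * `|j y - w| <= e / 2.
  rewrite -ler_pdivlMl// -(subrKA v) (le_trans (ler_normD _ _))//.
  rewrite [e / 2](_ : _ = e / 4 + e / 4); last by field.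
  by rewrite mulrDr lerD// mulrC ltW.
have kw' := rational_flag_sub kw.
have : range j w.
  rewrite range_j /=; apply: cvg_near_cst; exists k => // l /= kl.
  exact: weighted_dist_flag kl kw'.
move=> [z _ jz]; exists z; split; last by exists k => //=; rewrite jz.
apply: eU; rewrite -ball_normE/= (@le_lt_trans _ _ (e / 2))//; last first.
  by rewrite ltr_pdivrMr// ltr_pMr// ltr1n.
apply: norm_le_p => l; rewrite linearB jz; have [kl|lk] := leqP k l.
  rewrite (le_trans (weighted_distD _ _ _))//.
  rewrite -scaleN1r weighted_distZ (weighted_dist_flag kl kw') mulr0 addr0.
  by have := py l kl; lra.
rewrite (le_trans (weighted_dist_le_norm _ _))// (le_trans _ jyw)//.
by rewrite ler_wpM2r// ler_weXn2l ?ler1n// ltnW.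
Qed.

(* On these sets the norm of [Y] induces the topology of [X]: the weight [2^k]
   is beaten by the bound [4^-k]. *)
Definition fast_decay m : set X := [set x | forall k, (m <= k)%N ->
  subspace_dist (flag s (N k)) x <= 4^-1 ^+ k].

Lemma closed_fast_decay m : closed (fast_decay m).
Proof.
rewrite (_ : fast_decay m = \bigcap_(k in [set k | (m <= k)%N])
    [set x | subspace_dist (flag s (N k)) x <= 4^-1 ^+ k])//.
apply: closed_bigI => k _; apply: closed_sublevel.
exact: (continuous_subspace_dist (VS k)).
Qed.

Lemma fast_decay_weighted m k x : fast_decay m x -> (m <= k)%N ->
  p k x <= 2^-1 ^+ k.
Proof.
move=> mx mk; have -> : 2^-1 ^+ k = 2 ^+ k * 4^-1 ^+ k :> R.
  by rewrite -exprMn; congr (_ ^+ _); field.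
by rewrite ler_wpM2l ?exprn_ge0// mx.
Qed.

Lemma fast_decay_range m : fast_decay m `<=` range j.
Proof.
move=> x mx; rewrite range_j /=.
apply: (@squeeze_cvgr _ _ _ _ (cst 0) (geometric 1 (2^-1))).
- exists m => // k /= mk; rewrite mul1r weighted_dist_ge0/=.
  exact: fast_decay_weighted mx mk.
- exact: cvg_cst.
- by apply: cvg_geometric; rewrite ger0_norm// invf_lt1// ltr1n.
Qed.

(** It suffices that [g] is continuous on the set for the topology of [X]. For [k < l] the weights
    are at most [2 ^+ l], so closeness in [X] controls [p k (x - z)]; for [k >= l] both points have
    [p k] at most [2^-l]. *)
Lemma fast_decay_continuous m (F : Y -> R) (g : X -> Y) :
    (forall x, range j x -> j (g x) = x) -> continuous F ->
  {within fast_decay m, continuous (F \o g)}.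
Proof.
move=> jg cF; apply/subspace_continuousP => x mx.
have {}jg z : fast_decay m z -> j (g z) = z by move=> /fast_decay_range/jg.
suff cg : g @ within (fast_decay m) (nbhs x) --> g x.
  exact: (cvg_comp _ _ cg (cF (g x))).
apply/cvgrPdist_le => e e0.
have [l ml le] : exists2 l, (m <= l)%N & 2 * 2^-1 ^+ l <= e.
  have : geometric 2 (2^-1) @ \oo --> (0 : R).
    by apply: cvg_geometric; rewrite ger0_norm// invf_lt1// ltr1n.
  move=> /cvgr0Pnorm_lt/(_ e e0)[l _ le]; exists (maxn m l); first exact: leq_maxl.
  by rewrite ltW// (le_lt_trans (ler_norm _))// le//= leq_maxr.
have pow0 : 0 < 2 ^+ l :> R by rewrite exprn_gt0.
apply: filterS (nbhsx_ballx x (e / 2 ^+ l) (divr_gt0 e0 pow0)) => z.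
rewrite -ball_normE/= ltr_pdivlMr// mulrC => /ltW xz mz.
apply: norm_le_p => k; rewrite linearB !jg//; have [lk|kl] := leqP l k; last first.
  rewrite (le_trans (weighted_dist_le_norm _ _))// (le_trans _ xz)//.
  by rewrite ler_wpM2r// ler_weXn2l ?ler1n// ltnW.
rewrite (le_trans (weighted_distD _ _ _))// -scaleN1r weighted_distZ normrN1 mul1r.
rewrite (le_trans _ le)// mulr2n mulrDl !mul1r.
have half_le : 2^-1 ^+ k <= 2^-1 ^+ l :> R.
  by rewrite ler_wiXn2l// invf_le1// ler1n.
have mk := leq_trans ml lk.
by rewrite lerD// (le_trans (fast_decay_weighted _ mk)).
Qed.

(** Convergence to 0, spelled out with countable quantifiers, involves only the closed sets where
    [p k x <= 1/(i+1)]. *)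
Lemma borel_c0_range : measurable (range j : set (borel X)).
Proof.
have -> : range j = \bigcap_i \bigcup_l \bigcap_(k in [set k | (l <= k)%N])
    [set x | p k x <= i.+1%:R^-1].
  rewrite range_j; apply/seteqP; split => [x /= /cvgr0Pnorm_lt px i _|x xi].
    have [|l _ lx] := px i.+1%:R^-1; first by rewrite invr_gt0.
    by exists l => // k lk; rewrite /= ltW// (le_lt_trans (ler_norm _))// lx.
  apply/cvgr0Pnorm_lt => e e0.
  have [//|i] := @ltr_add_invr R 0 e; rewrite add0r => ie.
  have [l _ lx] := xi i I; exists l => // k lk /=.
  by rewrite ger0_norm ?weighted_dist_ge0// (le_lt_trans _ ie)// lx.
apply: bigcapT_measurable => i; apply: bigcupT_measurable => l.
apply: bigcap_measurableType => k _; apply: (@borel_closed _ X).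
by apply: closed_sublevel; exact: continuous_weighted_dist.
Qed.

(** On the range, a closed ball of [Y] is cut out by countably many closed conditions in [X], its
    norm being a supremum of continuous functions; off the range [g] is constant. *)
Lemma c0_inverse_borel (g : X -> Y) :
    (forall y, g (j y) = y) -> (forall x, ~ range j x -> g x = 0) ->
  measurable_fun [set: borel X] (g : borel X -> borel Y).
Proof.
move=> gK g0; apply: borel_fun_closed_ball; first exact: c0_separable.
move=> y e.
have -> : g @^-1` [set z | `|y - z| <= e] =
    (range j `&` \bigcap_k [set x | p k (j y - x) <= e]) `|`
    (~` range j `&` [set x | `|y| <= e]).
  apply/seteqP; split => [x /= xe|x [[[z _ <-] /= ze]|[/= jx ye]]].
  - have [[z _ zx]|jx] := pselect (range j x); [left|right].
      rewrite -zx; split; first by exists z.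
      move=> k _ /=; rewrite -linearB (le_trans (p_le_norm _ _))//.
      by move: xe; rewrite -zx gK.
    by split=> //; move: xe; rewrite g0// subr0.
  - by rewrite gK; apply: norm_le_p => k; rewrite linearB; exact: ze.
  - by rewrite g0// subr0.
apply: measurableU.
  apply: measurableI; first exact: borel_c0_range.
  apply: bigcapT_measurable => k; apply: (@borel_closed _ X).
  apply: closed_sublevel => x.
  apply: (@continuous_comp _ _ _ (fun z => j y - z) (p k)); last first.
    exact: continuous_weighted_dist.
  by apply: cvgB; [exact: cvg_cst|exact: cvg_id].
apply: measurableI; first by apply: measurableC; exact: borel_c0_range.
have [ye|ye] := boolP (`|y| <= e).
  by rewrite (_ : mkset _ = setT)//; apply/seteqP; split.
by rewrite (_ : mkset _ = set0)//; apply/seteqP; split => // x.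
Qed.

End Embedding.
End WeightedDistance.

(** * Uniform estimates under weak convergence *)

Section WeakConvergence.
Variables (R : realType) (X : completeNormedModType R).
Variables (mu_ : nat -> probability (borel X) R) (mu : probability (borel X) R).

(** [None] stands for the limit measure and [Some n] for [mu_ n], so that uniform bounds are stated
    once. *)
Let fam (o : option nat) := oapp mu_ mu o.

Lemma bounded_borel_integrable (P : probability (borel X) R) (f : borel X -> R) M :
  measurable_fun setT f -> (forall x, `|f x| <= M) -> P.-integrable setT (EFin \o f).
Proof.
move=> mf fM; apply: measurable_bounded_integrable => //.
  exact: le_lt_trans (probability_le1 P measurableT) (ltry 1).
by exists M; split=> [|x Mx y _]; [exact: num_real|exact: le_trans (ltW Mx)].
Qed.

(* As in Dini's theorem, monotonicity in [N] reduces uniformity to the limit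
   measure and the finitely many measures far from it. *)
Lemma weak_cvg_uniform_integral (f : nat -> X -> R) M e :
    weak_cvg mu_ mu ->
    (forall N, continuous (f N)) ->
    (forall N x, 0 <= f N x <= M) ->
    (forall m n x, (m <= n)%N -> f n x <= f m x) ->
    (forall x, f ^~ x @ \oo --> (0 : R)) -> 0 < e ->
  exists N, forall o, (\int[fam o]_(x in [set: borel X]) (f N x)%:E <= e%:E)%E.
Proof.
move=> cvmu cf f0M f_anti f0 e0.
have mf N : measurable_fun [set: borel X] (f N : borel X -> R).
  exact: continuous_borel_fun.
have f_ge0 N x : 0 <= f N x by have /andP[] := f0M N x.
have f_norm N x : `|f N x| <= M by rewrite ger0_norm//; have /andP[] := f0M N x.
have le_int (P : probability (borel X) R) m n : (m <= n)%N ->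
    (\int[P]_(x in [set: borel X]) (f n x)%:E <=
     \int[P]_(x in [set: borel X]) (f m x)%:E)%E.
  move=> mn; apply: ge0_le_integral => //.
  - by move=> x _; rewrite lee_fin.
  - exact/measurable_EFinP.
  - exact/measurable_EFinP.
  - by move=> x _; rewrite lee_fin f_anti.
have lt_nbhs (a b : \bar R) : (a < b)%E -> nbhs a [set x | (x < b)%E].
  by move=> ab; apply: open_nbhs_nbhs; split=> //; exact: open_ereal_lt_ereal.
have small (P : probability (borel X) R) : exists N,
    (\int[P]_(x in [set: borel X]) (f N x)%:E < e%:E)%E.
  have fx x : (f N x)%:E @[N --> \oo] --> 0%E.
    by apply: cvg_EFin; [exact: nearW|exact: f0].
  have [|||||_ _ /(_ _ (lt_nbhs _ e%:E _))] :=
    @dominated_convergence _ (borel X) R P setT measurableT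
      (fun N x => (f N x)%:E) (cst 0%E) (cst M%:E).
  - by move=> N; exact/measurable_EFinP.
  - exact: measurable_cst.
  - by apply: aeW => x _; exact: fx.
  - by apply: (@bounded_borel_integrable P (cst M) `|M|) => //;
      exact: measurable_cst.
  - by apply: aeW => x N _; rewrite /= lee_fin.
  rewrite integral0 lte_fin => /(_ e0)[N _ /(_ N (leqnn N))]; by exists N.
have [N1 N1e] := small mu.
have bN1 : bounded_fun (f N1).
  by exists M; split=> [|x Mx y _]; [exact: num_real|exact: le_trans (ltW Mx)].
have [n0 _ n0e] : \forall n \near \oo,
    (\int[mu_ n]_(x in [set: borel X]) (f N1 x)%:E < e%:E)%E.
  exact: (cvmu _ (cf N1) bN1 _ (lt_nbhs _ _ N1e)).
have /choice[N' N'e] := fun n => small (mu_ n).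
pose N := maxn N1 (\max_(n < n0) N' n).
exists N => -[n|]; rewrite /fam/=; last first.
  by rewrite (le_trans (le_int _ N1 N _)) ?leq_maxl// ltW.
have [n0n|nn0] := leqP n0 n.
  by rewrite (le_trans (le_int _ N1 N _)) ?leq_maxl// ltW// n0e.
rewrite (le_trans (le_int _ (N' n) N _)) ?(ltW (N'e n))//.
by rewrite leq_max (leq_bigmax (Ordinal nn0)) orbT.
Qed.

(** Markov's inequality for [h N] truncated at [d]: an integral of at most [d * e] bounds the tail
    by [e]. *)
Lemma weak_cvg_uniform_tail (h : nat -> X -> R) d e :
    weak_cvg mu_ mu ->
    (forall N, continuous (h N)) -> (forall N x, 0 <= h N x) ->
    (forall m n x, (m <= n)%N -> h n x <= h m x) ->
    (forall x, h ^~ x @ \oo --> (0 : R)) -> 0 < d -> 0 < e ->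
  exists N, forall o, (fam o [set x | (d < h N x)%R] <= e%:E)%E.
Proof.
move=> cvmu ch h_ge0 h_anti h0 d0 e0.
(* Truncation makes the functions bounded and keeps [f N x = d] wherever [d < h N x]. *)
pose f N x := Num.min (h N x) d.
have cf N : continuous (f N).
  by move=> x; apply: continuous_min; [exact: ch|exact: cst_continuous].
have f_ge0 N x : 0 <= f N x by rewrite le_min h_ge0 ltW.
have [||||||N fN] := @weak_cvg_uniform_integral f d (d * e) => //.
- by move=> N x; rewrite f_ge0/= ge_min lexx orbT.
- by move=> m n x mn; rewrite le_min !ge_min lexx orbT h_anti.
- move=> x; apply: (@squeeze_cvgr _ _ _ _ (cst 0) (h ^~ x)) => //.
    by apply: nearW => N; rewrite f_ge0/= ge_min lexx.
  exact: cvg_cst.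
- by rewrite mulr_gt0.
exists N => o; rewrite -(lee_pmul2l _ (_ : 0 < d%:E)%E)// -EFinM.
apply: le_trans (fN o).
have mf : measurable_fun [set: borel X] (f N : borel X -> R).
  exact: continuous_borel_fun.
have -> : (\int[fam o]_(x in [set: borel X]) (f N x)%:E =
    \int[fam o]_(x in [set: borel X]) `|(f N x)%:E|)%E.
  by apply: eq_integral => x _; rewrite gee0_abs// lee_fin.
have mf' : measurable_fun [set: borel X] (EFin \o (f N : borel X -> R)).
  exact/measurable_EFinP.
apply: le_trans (le_integral_abse (fam o) measurableT mf' d0).
apply: lee_wpmul2l; first by rewrite lee_fin ltW.
apply: le_measure; rewrite ?inE.
- by apply: borel_open; have /continuousP/(_ _ (@open_gt R d)) := ch N.
- by apply: emeasurable_fun_c_infty => //; exact: measurableT_comp.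
by move=> x /= dh; split=> //; rewrite lee_fin ler_normr le_min lexx (ltW dh).
Qed.

(** The two functions differ only off [K], and by at most [2 * M] there. *)
Lemma le_dist_integral (P : probability (borel X) R) (f h : borel X -> R)
    (K : set (borel X)) M e :
    measurable_fun setT f -> measurable_fun setT h -> measurable K ->
    (forall x, `|f x| <= M) -> (forall x, `|h x| <= M) ->
    (forall x, K x -> f x = h x) -> (P (~` K) <= e%:E)%E ->
  `|\int[P]_x f x - \int[P]_x h x| <= 2 * M * e.
Proof.
move=> mf mh mK fM hM fh Ke.
have intf := bounded_borel_integrable P mf fM.
have inth := bounded_borel_integrable P mh hM.
have intB : P.-integrable setT (EFin \o (fun x => f x - h x)).
  exact: (integrableB measurableT intf inth).
have M0 : 0 <= M by rewrite (le_trans _ (fM point)).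
rewrite -RintegralB// /Rintegral -lee_fin -fine_abse ?integrable_fin_num//.
rewrite fineK ?abse_fin_num ?integrable_fin_num//.
rewrite (le_trans (le_abse_integral P measurableT (measurable_int _ intB)))//.
apply: (@le_trans _ _ (\int[P]_(x in [set: borel X])
    ((2 * M)%:E * (\1_(~` K) x)%:E))%E).
  apply: ge0_le_integral => //.
  - exact/measurableT_comp/measurable_int/intB.
  - apply: measurable_funeM; apply/measurable_EFinP.
    exact/measurable_indic/measurableC.
  - move=> x _; rewrite lee_fin indicE; have [xK|xK] := boolP (x \in ~` K).
      rewrite mulr1 (le_trans (ler_normB _ _))// mulr2n mulrDl !mul1r.
      by rewrite lerD.
    by rewrite mulr0 fh ?subrr ?normr0//; move: xK; rewrite in_setC negbK inE.
rewrite ge0_integralZl//; last 2 first.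
- apply/measurable_EFinP; exact/measurable_indic/measurableC.
- by rewrite lee_fin mulr_ge0.
rewrite integral_indic//; last exact: measurableC.
by rewrite setIT (EFinM (2 * M)); apply: lee_wpmul2l => //; rewrite lee_fin mulr_ge0.
Qed.

(** By Tietze, [G] agrees on [K] with a continuous [F] having the same bound. Weak convergence
    applies to [F], and replacing [G] by [F] costs little, uniformly over the measures. *)
Lemma weak_cvg_nearly_continuous (G : borel X -> R) M :
    weak_cvg mu_ mu -> measurable_fun setT G -> (forall x, `|G x| <= M) ->
    (forall e, 0 < e -> exists K : set X, [/\ closed K,
       {within K, continuous (G : X -> R)} &
       forall o, (fam o (~` K) <= e%:E)%E]) ->
  (\int[mu_ n]_(x in [set: borel X]) (G x)%:E)%E @[n --> \oo]
    --> (\int[mu]_(x in [set: borel X]) (G x)%:E)%E.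
Proof.
move=> cvmu mG GM GK.
(* A strictly positive bound is needed for the extension and for the division below. *)
have M0 : 0 < `|M| + 1 by rewrite ltr_wpDl.
have {}GM x : `|G x| <= `|M| + 1.
  by rewrite (le_trans (GM x))// (le_trans (ler_norm _))// lerDl.
move: (`|M| + 1) M0 GM => {}M M0 GM.
have intE (P : probability (borel X) R) (f : borel X -> R) :
    measurable_fun setT f -> (forall x, `|f x| <= M) ->
    (\int[P]_(x in [set: borel X]) (f x)%:E)%E = (\int[P]_x f x)%:E.
  move=> mf fM; rewrite /Rintegral fineK//.
  exact: integrable_fin_num (bounded_borel_integrable P mf fM).
rewrite intE//; under eq_fun do rewrite intE//.
apply: cvg_EFin; first exact: nearW.
apply/cvgrPdist_le => e e0.
(* Then [2 * M] times this mass is [e / 3]: one third for each replacement of [G] by [F], one for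
   the convergence of the integrals of [F]. *)
have eM0 : 0 < e / (6 * M) by rewrite divr_gt0// mulr_gt0.
have [K [clK cK KM]] := GK _ eM0.
have [|F [GF cF FM]] := @continuous_bounded_extension X R
  pseudometric_normal K clK G M M0 cK; first by move=> x _; exact: GM.
have mF : measurable_fun [set: borel X] (F : borel X -> R).
  exact: continuous_borel_fun.
have FG x : K x -> G x = F x by move=> Kx; apply: GF; rewrite inE.
have close o : `|\int[fam o]_x G x - \int[fam o]_x F x| <= e / 3.
  rewrite (le_trans (le_dist_integral mG mF (borel_closed clK) GM FM FG (KM o)))//.
  by rewrite le_eqVlt; apply/orP; left; apply/eqP; field; rewrite gt_eqF.
have bF : bounded_fun F.
  by exists M; split=> [|x Mx y _]; [exact: num_real|exact: le_trans (ltW Mx)].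
have := cvmu F cF bF; rewrite intE//; under eq_fun do rewrite intE//.
move=> /fine_cvg/cvgrPdist_le/(_ (e / 3)) /=.
have e30 : 0 < e / 3 by rewrite divr_gt0.
move=> /(_ e30); apply: filterS => n /= FnF.
have := close None; have := close (Some n); rewrite /fam/= => Gn G0.
move: Gn G0 FnF; rewrite !ler_norml; lra.
Qed.

End WeakConvergence.

(** * Choice of the flag indices and uniform tightness *)

Section UniformTightness.
Variables (R : realType) (X : completeNormedModType R) (s : nat -> X).
Variables (mu_ : nat -> probability (borel X) R) (mu : probability (borel X) R).
Hypothesis s_dense : dense (range s).
Hypothesis cvmu : weak_cvg mu_ mu.

(** The complement of [fast_decay s N m.+1] is covered by the tail events of index above [m], whose
    masses [2^-k] sum to [2^-m]. *)
Lemma fast_decay_uniform : exists N : nat -> nat,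
  [/\ N 0%N = 0%N, {homo N : m n / (m <= n)%N} &
      forall e : R, 0 < e -> exists m, forall o,
        (oapp mu_ mu o (~` fast_decay s N m) <= e%:E)%E].
Proof.
have flagS n := flag_subspace s n.
have M_exists i : exists M, forall o,
    (oapp mu_ mu o [set x | (4^-1 ^+ i.+1 < subspace_dist (flag s M) x)%R]
      <= (1 / (2 ^ i.+1)%:R)%:E)%E.
  apply: (weak_cvg_uniform_tail cvmu (h := fun n => subspace_dist (flag s n))).
  - by move=> n; exact: continuous_subspace_dist.
  - by move=> n x; exact: subspace_dist_ge0.
  - by move=> m n x mn; apply: subspace_dist_anti => //; exact: flag_mono.
  - by move=> x; exact: subspace_dist_flag_cvg.
  - by rewrite exprn_gt0// invr_gt0.
  - by rewrite divr_gt0// ltr0n expn_gt0.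
have /choice[M Mtail] := M_exists.
(* A running maximum is monotone and starts at 0. [M k] controls the tail of index [k.+1], and
   [N k.+1] is at least [M k]. *)
pose N k := (\max_(i < k) M i)%N.
have N_mono : {homo N : m n / (m <= n)%N}.
  by move=> m n mn; apply/bigmax_leqP => i _; rewrite (leq_bigmax (widen_ord mn i)).
exists N; split => //; first by rewrite /N big_ord0.
move=> e e0.
pose tail n k : set (borel X) := [set x | 4^-1 ^+ n < subspace_dist (flag s k) x].
have mtail n k : measurable (tail n k).
  apply: (@borel_open _ X).
  by have /continuousP/(_ _ (@open_gt R (4^-1 ^+ n))) :=
    continuous_subspace_dist (flagS k).
have tail_le k o : (oapp mu_ mu o (tail k.+1 (N k.+1)) <= (1 / (2 ^ k.+1)%:R)%:E)%E.
  apply: le_trans (Mtail k o); apply: le_measure; rewrite ?inE; try exact: mtail.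
  move=> x /= /lt_le_trans; apply; apply: subspace_dist_anti => //.
  by apply: flag_mono; exact: (leq_bigmax (ord_max : 'I_k.+1)).
have [m me] : exists m, 1 / 2 ^+ m < e.
  have : geometric 1 (2^-1) @ \oo --> (0 : R).
    by apply: cvg_geometric; rewrite ger0_norm// invf_lt1// ltr1n.
  move=> /cvgr0Pnorm_lt/(_ e e0)[m _ /(_ m (leqnn m))] /= me; exists m.
  by rewrite -exprVn (le_lt_trans (ler_norm _)).
exists m.+1 => o.
apply: (@le_trans _ _
    (\sum_(k <oo) oapp mu_ mu o (tail (k + m).+1 (N (k + m).+1)))%E).
  apply: measure_sigma_subadditive => //.
    by apply: measurableC; apply: (@borel_closed _ X); exact: closed_fast_decay.
  move=> x /= /existsNP[k /not_implyP[mk /negP]]; rewrite -ltNge => kx.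
  by exists (k - m.+1)%N => //; rewrite /tail/= -addnS subnK.
apply: (@le_trans _ _ (\sum_(k <oo) (1 / (2 ^ (k + m.+1))%:R)%:E)%E).
  by apply: lee_nneseries => // k _; rewrite addnS.
have /cvg_lim -> // := @cvg_geometric_eseries_half R 1 m.
by rewrite lee_fin ltW.
Qed.

End UniformTightness.

(** * Transfer of the measures to [Y] and conclusion *)

(** The image of [mu] under [g] serves as [nu]. The image of [B] under [j] is the range of [j]
    intersected with the preimage of [B] under [g], hence Borel, and the two differ by a null
    set. *)
Lemma pushforward_restriction (R : realType) (X Y : completeNormedModType R)
    (j : Y -> X) (g : X -> Y) (mu : probability (borel X) R) :
    (forall y, g (j y) = y) -> concentrated_on mu (range j) ->
    measurable_fun [set: borel X] (g : borel X -> borel Y) ->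
  exists nu : probability (borel Y) R, is_restriction j mu nu /\
    forall (F : borel Y -> R) M, measurable_fun setT F -> (forall y, `|F y| <= M) ->
     (\int[nu]_(y in [set: borel Y]) (F y)%:E =
      \int[mu]_(x in [set: borel X]) (F (g x))%:E)%E.
Proof.
move=> gK [mj mu_j] mg.
pose g' : {mfun borel X >-> borel Y} :=
  MeasurableFun.Pack (MeasurableFun.Class (isMeasurableFun.Build _ _ _ _ _ mg)).
exists (distribution mu g'); split=> [B mB|F M mF FM].
  have jB : j @` B = range j `&` g @^-1` B.
    apply/seteqP; split => [_ [y By <-]|_ [[y _ <-]] /=].
      by split; [exists y|rewrite /= gK].
    by rewrite gK; exists y.
  have mgB : measurable (g @^-1` B : set (borel X)).
    by rewrite -[X in measurable X]setTI; exact: (mg measurableT B mB).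
  have mjgB : measurable (range j `&` g @^-1` B : set (borel X)).
    exact: measurableI.
  rewrite jB; split=> //; change (mu (g @^-1` B) = mu (range j `&` g @^-1` B)).
  apply/le_anti/andP; split; last first.
    by apply: le_measure; rewrite ?inE// => x [].
  (* Adding the null complement of the range leaves the bound unchanged and yields a set covering
     the preimage of [B]. *)
  rewrite -[leRHS]adde0 -mu_j.
  apply: (@le_trans _ _ (mu ((range j `&` g @^-1` B) `|` ~` range j))).
    apply: le_measure; rewrite ?inE//; last first.
      by move=> x gx; have [jx|jx] := pselect (range j x); [left|right].
    by apply: measurableU => //; exact: measurableC.
  by apply: measureU2 => //; exact: measurableC.
rewrite integral_distribution//; first exact/measurable_EFinP.
apply: (@bounded_borel_integrable _ X mu (F \o g) M).
  exact: (measurableT_comp mF mg).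
by move=> x; exact: FM.
Qed.

Theorem theorem2p1 (R : realType) (X : completeNormedModType R)
    (mu : probability (borel X) R) (mu_ : nat -> probability (borel X) R) :
  separable X ->
  weak_cvg mu_ mu ->
  exists (Y : completeNormedModType R) (j : {linear Y -> X}),
    [/\ separable Y,
        compact_embedding j,
        concentrated_on mu (range j),
        (forall n, concentrated_on (mu_ n) (range j)) &
        exists (nu : probability (borel Y) R) (nu_ : nat -> probability (borel Y) R),
          [/\ is_restriction j mu nu,
              (forall n, is_restriction j (mu_ n) (nu_ n)) &
              weak_cvg nu_ nu]].
Proof.
move=> /separable_seq[s s_dense] cvmu.
have [N [N0 N_mono tight]] := fast_decay_uniform s_dense cvmu.
have [|||Y [j [j_inj range_j p_le_norm norm_le_p]]] :=
  @exists_c0_space R X (weighted_dist s N) (weighted_dist0 s N0).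
- exact: weighted_distD.
- exact: weighted_distZ.
- by move=> k; exists (2 ^+ k) => x; exact: weighted_dist_le_norm.
have mj : measurable (range j : set (borel X)) := borel_c0_range range_j.
have conc o : concentrated_on (oapp mu_ mu o) (range j).
  split=> //; apply/le_anti; rewrite measure_ge0 andbT.
  (* The complement of the range lies in that of every [fast_decay s N m], so its mass is at most
     every positive [e]. *)
  apply/lee_addgt0Pr => e e0; rewrite add0e.
  have [m me] := tight e e0; apply: le_trans (me o).
  apply: le_measure; rewrite ?inE.
  - exact: measurableC.
  - by apply: measurableC; apply: (@borel_closed _ X); exact: closed_fast_decay.
  - apply: subsetC; exact: (fast_decay_range range_j).
(* A left inverse of [j], extended by 0 so that it stays Borel on all of [X]. *)
have [g gK g0] : exists2 g : X -> Y, (forall y, g (j y) = y) &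
    forall x, ~ range j x -> g x = 0.
  exists (fun x => xget 0 [set y | j y = x]) => [y|x jx].
    by apply: j_inj; apply: (@xgetPex _ 0 [set z | j z = j y]); exists y.
  by apply: xgetPN => y jy; apply: jx; exists y.
have mg := c0_inverse_borel N_mono j_inj range_j p_le_norm norm_le_p gK g0.
have /choice[nu nuP] := fun o => pushforward_restriction gK (conc o) mg.
exists Y, j; split.
- exact: (c0_separable N_mono j_inj range_j norm_le_p).
- exact: (c0_compact_embedding N0 j_inj p_le_norm).
- exact: conc None.
- by move=> n; exact: conc (Some n).
exists (nu None), (nu \o Some); split.
- by have [] := nuP None.
- by move=> n; have [] := nuP (Some n).
move=> F cF [M [_ FM]].
(* Boundedness of [F] provides a bound only for constants strictly above [M]. *)
have {}FM y : `|F y| <= M + 1 by apply: FM => //; rewrite ltrDl.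
have mF : measurable_fun [set: borel Y] (F : borel Y -> R).
  exact: continuous_borel_fun.
have nuE o := (nuP o).2 F _ mF FM.
(* Change of variables reduces the claim to the original measures on [X] and the function [F \o g],
   continuous on each [fast_decay] set. *)
rewrite (nuE None); under eq_fun do rewrite (nuE (Some _)).
apply: (@weak_cvg_nearly_continuous R X mu_ mu (F \o g) (M + 1)) => //.
- exact: (measurableT_comp mF mg).
- by move=> x; exact: FM.
move=> e e0; have [m me] := tight e e0.
exists (fast_decay s N m); split => //; first exact: closed_fast_decay.
apply: (fast_decay_continuous range_j norm_le_p) => // x [y _ <-].
by rewrite gK.
Qed.
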